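(* For every $n\ge 5$ and every odd $k$ with $3\le k\le 2n-3$, there exists a tournament $T_{n,k}$ on $n$ vertices such that $\overrightarrow{trc}(T_{n,k})=\overrightarrow{strc}(T_{n,k})=k$.
   Context: A tournament is a digraph in which every two distinct vertices are joined by exactly one arc (in one direction), with no loops. For a strongly connected digraph $D$ (every ordered pair joined by a directed path): a directed path is total-rainbow if its arcs and internal vertices all receive pairwise distinct colours under a total-colouring (colouring of vertices and arcs); $\overrightarrow{trc}(D)$ (resp. $\overrightarrow{strc}(D)$) is the minimum number of colours in a total-colouring such that every ordered pair $(u,v)$ is joined by a total-rainbow $u$–$v$ path (resp. total-rainbow shortest $u$–$v$ path). *)

(* Defs.v *)
From mathcomp Require Import all_boot.

Set Implicit Arguments.
Unset Strict Implicit.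
Unset Printing Implicit Defensive.

(* A digraph on the vertex set T is a relation [D : rel T]; [D x y] says that
   the arc from x to y is present.  As in path.v, the pair [(u, p)] encodes the
   vertex sequence [u :: p]. *)

Section Digraph.

Variables (T : finType) (D : rel T).

Definition tournament : Prop :=
  irreflexive D /\ (forall x y, x != y -> D x y (+) D y x).

Definition strongly_connected : Prop := forall x y, connect D x y.

Definition dipath (u v : T) (p : seq T) : Prop :=
  [/\ path D u p, last u p = v & uniq (u :: p)].

Definition shortest_dipath (u v : T) (p : seq T) : Prop :=
  dipath u v p /\ (forall q, dipath u v q -> size p <= size q).

Definition internal_vertices (u : T) (p : seq T) : seq T :=
  behead (belast u p).

Definition path_arcs (u : T) (p : seq T) : seq (T * T) :=
  zip (belast u p) p.

(* A total-colouring consists of a vertex colouring [cv] and an arc colouring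
   [ca]; the latter is given on all pairs, but its values on pairs that are not
   arcs of D are never inspected. *)
Definition total_rainbow (C : eqType) (cv : T -> C) (ca : T * T -> C)
    (u : T) (p : seq T) : bool :=
  uniq (map ca (path_arcs u p) ++ map cv (internal_vertices u p)).

Definition total_rainbow_connected (C : eqType) (cv : T -> C)
    (ca : T * T -> C) : Prop :=
  forall u v, exists2 p, dipath u v p & total_rainbow cv ca u p.

Definition strongly_total_rainbow_connected (C : eqType) (cv : T -> C)
    (ca : T * T -> C) : Prop :=
  forall u v, exists2 p, shortest_dipath u v p & total_rainbow cv ca u p.

End Digraph.

Definition is_minimum (P : nat -> Prop) (k : nat) : Prop :=
  P k /\ (forall m, P m -> k <= m).

(* [is_trc D k] and [is_strc D k] say that the (strong) total rainbow connection
   number of D is k.  Colours range over ['I_m] without a surjectivity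
   requirement: allowing unused colours does not change the minimum. *)
Definition is_trc (T : finType) (D : rel T) : nat -> Prop :=
  is_minimum (fun m => exists (cv : T -> 'I_m) (ca : T * T -> 'I_m),
    total_rainbow_connected D cv ca).

Definition is_strc (T : finType) (D : rel T) : nat -> Prop :=
  is_minimum (fun m => exists (cv : T -> 'I_m) (ca : T * T -> 'I_m),
    strongly_total_rainbow_connected D cv ca).

(* Main.v *)
(* Put k = 2d - 1.  A path of length d has d arcs and d - 1 internal vertices,
   so a tournament of diameter d needs at least k colours, and it suffices to
   find one with k colours in which all pairs are joined by total-rainbow
   shortest paths.  For d >= 3, use the d + 1 layers of a path whose arcs between
   non-consecutive layers all point backwards; layer 0 is a transitive
   tournament and absorbs the extra vertices.  For d = 2, every arc must lie in
   a cyclic triangle whose other two arcs and the vertex between them have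
   distinct colours, and such tournaments can be enlarged by two vertices. *)

Require Import Defs.
From mathcomp Require Import all_boot zify.

Set Implicit Arguments.
Unset Strict Implicit.
Unset Printing Implicit Defensive.

(** * Counting colours and the reduction to diameter *)

Lemma size_total_rainbow_word (T : finType) (C : eqType) (cv : T -> C)
    (ca : T * T -> C) u p :
  size (map ca (path_arcs u p) ++ map cv (internal_vertices u p))
  = (size p).*2.-1.
Proof.
rewrite size_cat !size_map size_zip size_behead size_belast minnn; lia.
Qed.

Lemma total_rainbow_size (T : finType) m (cv : T -> 'I_m)
    (ca : T * T -> 'I_m) u p :
  total_rainbow cv ca u p -> (size p).*2.-1 <= m.
Proof.
move=> /card_uniqP; rewrite size_total_rainbow_word => <-.
by rewrite -[X in _ <= X]card_ord max_card.
Qed.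

Lemma uniq_map_inord m (s : seq nat) :
  all (fun i => i <= m) s -> uniq s -> uniq (map (@inord m) s).
Proof.
move=> /allP s_le; rewrite map_inj_in_uniq // => i j /s_le i_le /s_le j_le.
by move/(congr1 val); rewrite /= !inordK.
Qed.

(** Natural-number colours are easier to compute with. Bounding only those met along [p] suffices
    for [inord] to keep them distinct. *)
Definition total_rainbow_below (T : finType) (k : nat) (cv : T -> nat)
    (ca : T * T -> nat) (u : T) (p : seq T) : bool :=
  total_rainbow cv ca u p &&
  all (fun c => c < k) (map ca (path_arcs u p) ++ map cv (internal_vertices u p)).

(** The far pair forces [d.*2.+1] colours for any rainbow paths, and the given shortest paths attain
    this number. The diameter here is [d.+1]. *)
Lemma is_trc_strc_diameter (T : finType) (D : rel T) (d : nat) (cv : T -> nat)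
    (ca : T * T -> nat) (u0 v0 : T) :
    (forall p, dipath D u0 v0 p -> d.+1 <= size p) ->
    (forall u v, exists2 p, shortest_dipath D u v p &
                            total_rainbow_below d.*2.+1 cv ca u p) ->
  [/\ strongly_connected D, is_trc D d.*2.+1 & is_strc D d.*2.+1].
Proof.
move=> far short.
have strong : strongly_total_rainbow_connected D
    (fun x => @inord d.*2 (cv x)) (fun e => @inord d.*2 (ca e)).
  move=> u v; have [p pP /andP[rainbow bound]] := short u v.
  exists p => //; rewrite /total_rainbow (map_comp (@inord _) ca).
  by rewrite (map_comp (@inord _) cv) -map_cat uniq_map_inord.
have lower m (cv' : T -> 'I_m) (ca' : T * T -> 'I_m) :
    total_rainbow_connected D cv' ca' -> d.*2.+1 <= m.
  move=> /(_ u0 v0)[p /far p_ge /total_rainbow_size]; lia.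
have weaken m (cv' : T -> 'I_m) (ca' : T * T -> 'I_m) :
    strongly_total_rainbow_connected D cv' ca' ->
    total_rainbow_connected D cv' ca'.
  by move=> conn u v; have [p [pP _] ?] := conn u v; exists p.
split.
- move=> u v; have [p [[pD pv _] _] _] := short u v.
  by apply/connectP; exists p.
- split; first by do 2!eexists; exact: weaken strong.
  by move=> m [cv' [ca' /lower]].
- split; first by do 2!eexists; exact: strong.
  by move=> m [cv' [ca' /weaken/lower]].
Qed.

(** * Shortest paths with at most two arcs *)

Section ShortDipaths.

Variables (T : finType) (D : rel T).
Hypothesis D_irr : irreflexive D.

Lemma shortest_dipath_nil u : shortest_dipath D u u [::].
Proof. by []. Qed.

Lemma shortest_dipath_arc u v : D u v -> shortest_dipath D u v [:: v].
Proof.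
move=> Duv; have neq_uv : u != v by apply: contraTneq Duv => ->; rewrite D_irr.
split; first by split=> //=; rewrite ?Duv // inE neq_uv.
by case=> [[/= _ uv]|//]; rewrite uv eqxx in neq_uv.
Qed.

Lemma dipath_nonarc u v p : u != v -> ~~ D u v -> dipath D u v p -> 2 <= size p.
Proof.
move=> neq_uv nDuv [pD pv _]; case: p pD pv => [_ uv|x [/= /andP[Dux _] xv|//]].
  by rewrite -uv eqxx in neq_uv.
by rewrite -xv Dux in nDuv.
Qed.

Lemma shortest_dipath2 u w v :
  u != v -> ~~ D u v -> D u w -> D w v -> shortest_dipath D u v [:: w; v].
Proof.
move=> neq_uv nDuv Duw Dwv.
have neq_uw : u != w by apply: contraTneq Duw => ->; rewrite D_irr.
have neq_wv : w != v by apply: contraTneq Dwv => ->; rewrite D_irr.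
split; last by move=> q; apply: dipath_nonarc.
by split; rewrite /= ?Duw ?Dwv // !inE negb_or neq_uw neq_uv neq_wv.
Qed.

End ShortDipaths.

(** * Diameter 2: tournaments with rainbow triangles *)

Record rainbow_triangles (n : nat) (D : rel nat) (cv : nat -> nat)
    (ca : nat -> nat -> nat) : Prop := RainbowTriangles {
  rt_irr : forall x, x < n -> ~~ D x x;
  rt_total : forall x y, x < n -> y < n -> x != y -> D x y (+) D y x;
  rt_triangle : forall x y, x < n -> y < n -> D y x -> exists2 w, w < n &
    [&& D x w, D w y & uniq [:: ca x w; ca w y; cv w]];
  rt_colours : forall x y, x < n -> y < n -> (cv x < 3) && (ca x y < 3);
  rt_zero : exists2 x, x < n & cv x = 0 }.

(** Vertices and colours are plain naturals, so explicit instances are settled by evaluation. *)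
Definition rainbow_triangles_test (n : nat) (D : rel nat) (cv : nat -> nat)
    (ca : nat -> nat -> nat) : bool :=
  let V := iota 0 n in
  [&& all (fun x => ~~ D x x) V,
      all (fun x => all (fun y => (x != y) ==> (D x y (+) D y x)) V) V,
      all (fun x => all (fun y => D y x ==> has (fun w =>
        [&& D x w, D w y & uniq [:: ca x w; ca w y; cv w]]) V) V) V,
      all (fun x => all (fun y => (cv x < 3) && (ca x y < 3)) V) V &
      has (fun x => cv x == 0) V].

Lemma rainbow_triangles_testP n D cv ca :
  rainbow_triangles_test n D cv ca -> rainbow_triangles n D cv ca.
Proof.
have memV x : (x \in iota 0 n) = (x < n) by rewrite mem_iota.
case/and5P=> /allP irr /allP tot /allP tri /allP col /hasP[z zV /eqP cz0].
split=> [x xn|x y xn yn|x y xn yn Dyx|x y xn yn|].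
- by apply: irr; rewrite memV.
- have /allP/(_ y) := tot x ltac:(by rewrite memV).
  by rewrite memV yn => /(_ isT)/implyP.
- have /allP/(_ y) := tri x ltac:(by rewrite memV).
  rewrite memV yn => /(_ isT)/implyP/(_ Dyx)/hasP[w]; rewrite memV.
  by exists w.
- by have /allP/(_ y) := col x ltac:(by rewrite memV); rewrite memV yn; apply.
- by exists z; rewrite -?memV.
Qed.

(** In the cyclic triangle, each vertex takes the one colour missing from its two arcs. *)
Lemma rainbow_triangles3 : exists D cv ca, rainbow_triangles 3 D cv ca.
Proof.
exists (fun x y => y == x.+1 %% 3),
  (nth 0 [:: 2; 1; 0]), (fun x _ => nth 0 [:: 0; 2; 1] x).
by apply: rainbow_triangles_testP; vm_compute.
Qed.

(* The two matrices were found by computer search; no tournament on four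
   vertices has diameter 2, so even orders cannot start lower. *)
Lemma rainbow_triangles6 : exists D cv ca, rainbow_triangles 6 D cv ca.
Proof.
pose A := [:: [:: 0; 1; 1; 0; 0; 1]; [:: 0; 0; 1; 1; 0; 1];
              [:: 0; 0; 0; 1; 1; 0]; [:: 1; 0; 0; 0; 0; 1];
              [:: 1; 1; 0; 1; 0; 0]; [:: 0; 0; 1; 0; 1; 0]].
pose M := [:: [:: 0; 0; 0; 0; 0; 0]; [:: 0; 0; 0; 1; 0; 0];
              [:: 0; 0; 0; 1; 1; 0]; [:: 2; 0; 0; 0; 0; 2];
              [:: 2; 2; 0; 2; 0; 0]; [:: 0; 0; 2; 0; 1; 0]].
exists (fun x y => nth 0 (nth [::] A x) y == 1), (nth 0 [:: 1; 1; 2; 0; 0; 0]).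
exists (fun x y => nth 0 (nth [::] M x) y).
by apply: rainbow_triangles_testP; vm_compute.
Qed.

(* The new vertex [n] dominates all old vertices and [n.+1] is dominated by
   them; an old vertex of colour 0 closes the triangle on the arc from [n.+1]
   to [n]. *)
Lemma rainbow_trianglesSS n :
  (exists D cv ca, rainbow_triangles n D cv ca) ->
  exists D cv ca, rainbow_triangles n.+2 D cv ca.
Proof.
move=> [D [cv [ca [irr tot tri col [z zn cz0]]]]].
exists (fun u v => if u < n then (if v < n then D u v else v == n.+1)
                   else if u == n then v < n else v == n).
exists (fun u => if u < n then cv u else if u == n then 2 else 1).
exists (fun u v => if u < n then (if v < n then ca u v else 2)
                   else if u == n then 1 else 0).
have splitV x : x < n.+2 -> [\/ x < n, x = n | x = n.+1].
  rewrite !ltnS leq_eqVlt ltnS leq_eqVlt => /or3P[/eqP|/eqP|] ?;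
    by [constructor 3 | constructor 2 | constructor 1].
have SnF : n.+1 < n = false by lia.
have eqSn : (n.+1 == n) = false by lia.
have eqnS : (n == n.+1) = false by lia.
split=> [x|x y|x y|x y|].
- by case/splitV=> [xn|->|->]; rewrite ?xn ?ltnn ?SnF ?eqxx ?eqSn ?irr.
- case/splitV=> [xn|->|->] /splitV[yn|->|->];
    rewrite ?xn ?yn ?ltnn ?SnF ?eqxx ?eqSn ?eqnS ?(ltn_eqF xn) ?(ltn_eqF yn) //;
    exact: tot.
- case/splitV=> [xn|->|->] /splitV[yn|->|->];
    rewrite ?xn ?yn ?ltnn ?SnF ?eqxx ?eqSn ?eqnS ?(ltn_eqF xn) ?(ltn_eqF yn) //.
  + move=> /(tri _ _ xn yn)[w wn wP].
    by exists w; [lia | rewrite wn].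
  (* The paths [x -> n.+1 -> n], [n -> z -> n.+1] and [n.+1 -> n -> y] have arc colours 2, 0, then
     1, 2, then 0, 1; their middle vertices have the third colour. *)
  + by exists n.+1; rewrite ?SnF ?eqSn ?eqxx.
  + by exists z; [lia | rewrite zn cz0 ?SnF ?eqxx].
  + by exists n; [lia | rewrite ltnn eqxx].
- case/splitV=> [xn|->|->] /splitV[yn|->|->];
    rewrite ?xn ?yn ?ltnn ?SnF ?eqxx ?eqSn //=; first exact: col;
    by have /andP[-> _] := col x x xn xn.
- by exists z; [lia | rewrite zn].
Qed.

Lemma rainbow_triangles_exists n :
  5 <= n -> exists D cv ca, rainbow_triangles n D cv ca.
Proof.
have odd_case m : exists D cv ca, rainbow_triangles m.*2.+3 D cv ca.
  by elim: m => [|m IH]; [exact: rainbow_triangles3 | exact: rainbow_trianglesSS].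
have even_case m : exists D cv ca, rainbow_triangles (m.*2 + 6) D cv ca.
  elim: m => [|m IH]; [exact: rainbow_triangles6 | exact: rainbow_trianglesSS].
move=> n5; case: (boolP (odd n)) => odd_n.
  by have := odd_case (n - 3)./2; rewrite (_ : _.*2.+3 = n) //; lia.
by have := even_case (n - 6)./2; rewrite (_ : _ + 6 = n) //; lia.
Qed.

Lemma diameter2_case n : 5 <= n ->
  exists D : rel 'I_n,
    [/\ tournament D, strongly_connected D, is_trc D 3 & is_strc D 3].
Proof.
move=> n5; have [D [cv [ca [irr tot tri col _]]]] := rainbow_triangles_exists n5.
pose E : rel 'I_n := fun x y => D x y.
have E_irr : irreflexive E by move=> x; apply/negbTE/irr.
have E_tot x y : x != y -> E x y (+) E y x by move=> ?; apply: tot.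
exists E.
have n0 : 0 < n by lia.
have n1 : 1 < n by lia.
pose o0 : 'I_n := Ordinal n0; pose o1 : 'I_n := Ordinal n1.
(* One of two opposite pairs is not an arc; its distance is at least 2. *)
have [u0 [v0 [neq_uv nE]]] : exists u0 v0, u0 != v0 /\ ~~ E u0 v0.
  case: (boolP (E o0 o1)) => E01; last by exists o0, o1.
  by exists o1, o0; split=> //; have := E_tot o0 o1 isT; rewrite E01.
have [] // := @is_trc_strc_diameter _ E 1 (fun x => cv x)
  (fun e => ca e.1 e.2) u0 v0.
- by move=> p; apply: dipath_nonarc.
move=> u v; have [->|neq] := eqVneq u v.
  by exists [::]; first exact: shortest_dipath_nil.
case: (boolP (E u v)) => Euv.
  exists [:: v]; first exact: shortest_dipath_arc.
  rewrite /total_rainbow_below /= andbT.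
  by have /andP[] := col u v (ltn_ord u) (ltn_ord v).
have Evu : E v u by have := E_tot _ _ neq; rewrite (negbTE Euv).
have [w wn /and3P[Duw Dwv rainbow]] := tri _ _ (ltn_ord u) (ltn_ord v) Evu.
exists [:: Ordinal wn; v]; first exact: shortest_dipath2.
have /andP[cw cwv] := col w v wn (ltn_ord v).
have /andP[_ cuw] := col u w (ltn_ord u) wn.
by apply/andP; split; [exact: rainbow | rewrite /= cw cwv cuw].
Qed.

(** * Diameter at least 3: layered tournaments *)

Section Layered.

Variables m e : nat.
Hypothesis e_ge2 : 2 <= e.

Let T : finType := 'I_(m + e.+1).+1.

(** Truncated subtraction puts vertices 0 to [m] in layer 0; layers 1 to [e.+1] are single
    vertices. *)
Definition layer (x : T) : nat := x - m.

Definition layered : rel T := fun x y =>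
  if (layer x == 0) && (layer y == 0) then x < y
  else (layer y == (layer x).+1) || ((layer y).+1 < layer x).

(** On ascending paths arcs get even colours and internal vertices odd ones. Colour 2 serves detours
    through layer 0, whose arcs have colours 4 and 0. The colour of layer [e.+1] is out of range,
    but that layer is never internal to a chosen path. *)
Definition layer_colour (l : nat) : nat := if l == 0 then 2 else l.*2.-1.

Definition layer_arc_colour (l l' : nat) : nat :=
  if l' == l.+1 then l.*2 else if l' == 0 then 4 else 0.

Definition layered_cv (x : T) : nat := layer_colour (layer x).

Definition layered_ca (a : T * T) : nat :=
  layer_arc_colour (layer a.1) (layer a.2).

Lemma layer_le x : layer x <= e.+1.
Proof. by rewrite /layer; have := ltn_ord x; lia. Qed.

Lemma layer_inj x y : layer x = layer y -> 0 < layer y -> x = y.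
Proof. by rewrite /layer => ? ?; apply: val_inj; rewrite /=; lia. Qed.

Lemma layer_surj l : l <= e.+1 -> exists w, layer w = l.
Proof. by move=> ?; exists (inord (m + l)); rewrite /layer inordK; lia. Qed.

Lemma layered_tournament : tournament layered.
Proof.
split=> [x|x y neq_xy]; rewrite /layered; first by case: ifP; lia.
have neq : (x : nat) <> y by move/val_inj/eqP; apply/negP.
have eq_layer : layer x = layer y -> layer y = 0.
  by move=> eq_l; case: (posnP (layer y)) => // /(layer_inj eq_l) /(congr1 val)/neq.
by case: ifP; case: ifP; lia.
Qed.

Lemma layered_layer x y : layered x y -> layer y <= (layer x).+1.
Proof. by rewrite /layered; case: ifP; lia. Qed.

(** Each arc climbs at most one layer. Hence ascending paths are shortest, and going from the first
    vertex to the last takes at least [e.+1] arcs. *)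
Lemma layer_path u p : path layered u p -> layer (last u p) <= layer u + size p.
Proof.
elim: p u => [|x p IH] u /=; first by rewrite addn0.
case/andP=> /layered_layer lx /IH/leq_trans; apply.
by rewrite addnS -addSn leq_add2r.
Qed.

Lemma ascending_path u v j : layer v = layer u + j.+1 ->
  exists p, [/\ path layered u p, last u p = v &
                map layer p = iota (layer u).+1 j.+1].
Proof.
elim: j u => [|j IH] u lv.
  by exists [:: v]; rewrite /= /layered; split=> //; [case: ifP; lia | congr [:: _]; lia].
have [|w lw] := @layer_surj (layer u).+1; first by have := layer_le v; lia.
have [|p [wp pv lp]] := IH w; first lia.
exists (w :: p); split=> //=; last by rewrite lp lw.
by rewrite wp andbT /layered lw eqxx andbF.
Qed.

Lemma ascending_arc_colours u p : map layer p = iota (layer u).+1 (size p) ->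
  map layered_ca (path_arcs u p) = map double (iota (layer u) (size p)).
Proof.
elim: p u => //= x p IH u [lx lp].
by rewrite -/(path_arcs x p) IH ?lx // /layered_ca /= lx /layer_arc_colour eqxx.
Qed.

Lemma ascending_internal_colours u p : map layer p = iota (layer u).+1 (size p) ->
  map layered_cv (internal_vertices u p)
  = [seq l.*2.-1 | l <- iota (layer u).+1 (size p).-1].
Proof.
case: p => //= x p [lx lp]; rewrite /internal_vertices /=.
elim: p x u lx lp => //= y p IH x u lx [ly lp].
by rewrite (IH y x) lx //; congr (_ :: _); rewrite /layered_cv lx.
Qed.

Lemma ascending_rainbow u p : layer u + size p <= e.+1 ->
  map layer p = iota (layer u).+1 (size p) ->
  total_rainbow_below e.*2.+1 layered_cv layered_ca u p.
Proof.
move=> p_le lp; rewrite /total_rainbow_below /total_rainbow.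
rewrite ascending_arc_colours // ascending_internal_colours //.
apply/andP; split.
  rewrite cat_uniq map_inj_uniq ?iota_uniq; last exact: double_inj.
  rewrite map_inj_in_uniq ?iota_uniq /= ?andbT.
    (* Here [i] is positive, so [i.*2.-1] is odd and differs from every arc colour. *)
    apply/hasPn => _ /mapP[i i_in ->]; apply/mapP=> -[j _].
    by move: i_in; rewrite mem_iota; lia.
  by move=> i j; rewrite !mem_iota; lia.
apply/allP=> c; rewrite mem_cat => /orP[] /mapP[i]; rewrite mem_iota; lia.
Qed.

Lemma ascending_dipath u v : layer u < layer v ->
  exists2 p, shortest_dipath layered u v p &
             total_rainbow_below e.*2.+1 layered_cv layered_ca u p.
Proof.
move=> lt_uv; have [|p [up pv lp]] := @ascending_path u v (layer v - layer u).-1.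
  lia.
have sz : size p = layer v - layer u by rewrite -(size_map layer) lp size_iota; lia.
exists p; last first.
  apply: ascending_rainbow; first by have := layer_le v; lia.
  by rewrite lp; congr (iota _ _); lia.
split; last by move=> q [/layer_path + qv _]; rewrite qv; lia.
split=> //; apply: (@map_uniq _ _ layer); rewrite /= lp.
exact: (iota_uniq _ (_.+2)).
Qed.

Lemma total_rainbow_below1 u v :
  total_rainbow_below e.*2.+1 layered_cv layered_ca u [:: v].
Proof.
rewrite /total_rainbow_below /= andbT /layered_ca /layer_arc_colour /=.
by have := layer_le v; do 2?case: ifP; lia.
Qed.

Lemma layered_two_step u w v :
  u != v -> ~~ layered u v -> layered u w -> layered w v ->
  uniq [:: layered_ca (u, w); layered_ca (w, v); layered_cv w] ->
  all (fun c => c < e.*2.+1)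
    [:: layered_ca (u, w); layered_ca (w, v); layered_cv w] ->
  exists2 p, shortest_dipath layered u v p &
             total_rainbow_below e.*2.+1 layered_cv layered_ca u p.
Proof.
move=> neq nuv uw wv rainbow below; exists [:: w; v]; last exact/andP.
by apply: shortest_dipath2 => //; case: layered_tournament.
Qed.

(* Going back inside layer 0 needs a detour of length 3 through layers 1 and 2. *)
Lemma layer0_dipath (u v : T) : layer u = 0 -> layer v = 0 -> v < u ->
  exists2 p, shortest_dipath layered u v p &
             total_rainbow_below e.*2.+1 layered_cv layered_ca u p.
Proof.
move=> lu lv lt_vu.
have [//|w1 l1] := @layer_surj 1; have [|w2 l2] := @layer_surj 2; first lia.
have neq x y : layer x <> layer y -> x != y by move=> ne; apply: contra_not_neq ne => ->.
have neq_uv : u != v by apply/eqP=> uv; rewrite uv ltnn in lt_vu.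
have nuv : ~~ layered u v by rewrite /layered lu lv /=; lia.
exists [:: w1; w2; v].
  split; first split=> //=.
  - by rewrite /layered lu lv l1 l2.
  - by rewrite !inE !negb_or neq_uv !neq ?lu ?lv ?l1 ?l2.
  (* Two arcs do not suffice: a middle vertex in layer 0 would give [u < x < v], and one in layer 1
     has no arc back to layer 0. *)
  move=> q q_path; have := dipath_nonarc neq_uv nuv q_path.
  case: q q_path => [|x [|y [|? ?]]] //= [/= /and3P[ux xy _] yv _].
  move: ux xy; rewrite yv /layered lu lv; case: (posnP (layer x)) => [->|lx] /=.
    by move=> ux xv; have := ltn_trans ux (ltn_trans xv lt_vu); rewrite ltnn.
  by lia.
(* The arcs have colours 0, 2, 4 and the internal vertices 1, 3. *)
rewrite /total_rainbow_below /total_rainbow /= /layered_ca /layered_cv.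
by rewrite /= lu lv l1 l2 /layer_arc_colour /layer_colour /= -!muln2; lia.
Qed.

Lemma layered_short u v :
  exists2 p, shortest_dipath layered u v p &
             total_rainbow_below e.*2.+1 layered_cv layered_ca u p.
Proof.
have [->|neq] := eqVneq u v; first by exists [::]; first exact: shortest_dipath_nil.
have [irr tot] := layered_tournament.
case: (boolP (layered u v)) => Duv.
  exists [:: v]; last exact: total_rainbow_below1.
  exact: shortest_dipath_arc.
have [/ascending_dipath //|le_vu] := ltnP (layer u) (layer v).
have := Duv; rewrite {1}/layered; case: ifP => [/andP[/eqP lu /eqP lv]|nz].
  move=> le'; apply: layer0_dipath => //.
  have : (u : nat) <> v by move/val_inj/eqP; apply/negP.
  lia.
(* Drops of two or more layers are arcs and positive layers are single vertices, so only a descent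
   by one layer remains. *)
move=> nD; have lu : layer u = (layer v).+1.
  have [eq_l|] := eqVneq (layer u) (layer v); last lia.
  case/negP: neq; apply/eqP/layer_inj => //; lia.
have lu_le := layer_le u.
have [lv|lv_gt0] := posnP (layer v).
  (* From layer 1 to layer 0 through layer 2: arc colours 2 and 4, vertex colour 3. *)
  have [|w lw] := @layer_surj 2; first lia.
  apply: (layered_two_step (w := w)) => //;
    by rewrite /layered /layered_ca /layered_cv /= ?lu ?lw ?lv
               /layer_arc_colour /layer_colour /= -?muln2; lia.
(* Fall to the layer [l] just below [v], then climb: arc colours 0 and [l.*2], vertex colour
   [l.*2.-1], or 4, 0 and 2 if [l] is 0. *)
have [|w lw] := @layer_surj (layer v).-1; first lia.
case lv: (layer v) lv_gt0 lu lw => [//|l] _ lu /= lw.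
apply: (layered_two_step (w := w)) => //;
  rewrite /layered /layered_ca /layered_cv /= ?lu ?lw ?lv ?eqxx ?andbF //=;
  first lia; rewrite /layer_arc_colour /layer_colour ?eqxx;
  case: l {lw} lv lu => [|l] lv lu /=; rewrite ?inE -?muln2; do ?case: ifP; lia.
Qed.

Lemma layered_case :
  exists D : rel T,
    [/\ tournament D, strongly_connected D, is_trc D e.*2.+1 & is_strc D e.*2.+1].
Proof.
exists layered.
have [] // := @is_trc_strc_diameter _ layered e layered_cv layered_ca ord0 ord_max.
- move=> p [/layer_path + pv _]; rewrite pv /layer /=; lia.
- exact: layered_short.
by split=> //; apply: layered_tournament.
Qed.

End Layered.

Theorem theorem17 (n k : nat) (hn : 5 <= n) (hodd : odd k)
    (hk : 3 <= k <= 2 * n - 3) :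
  exists D : rel 'I_n,
    [/\ tournament D, strongly_connected D, is_trc D k & is_strc D k].
Proof.
have [->|k3] := eqVneq k 3; first exact: diameter2_case.
(* Take [e = k./2], at least 2 because [k] is now at least 5. The upper bound on [k] keeps the
   subtraction in [m = n - k./2.+2] from truncating. *)
have -> : k = (k./2).*2.+1 by lia.
have -> : n = ((n - k./2.+2) + k./2.+1).+1 by lia.
by apply: layered_case; lia.
Qed.
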